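(* Let $n\in\mathbb N$ and let $\varphi:\mathbb R\to\mathbb R$ be continuous such that $\lim_{x\to-\infty}\varphi(x)$ and $\lim_{x\to\infty}\varphi(x)$ exist and are finite and unequal. Then $$\overline{\mathcal N_\varphi^\infty(\mathbb R^n)}=\overline{\mathcal N_\varphi^2(\mathbb R^n)}=\mathfrak S(\mathbb R^n).$$ Moreover, for every $m\in\mathbb N$ (networks with $m$ output nodes), $$\overline{\mathcal N_\varphi^\infty(\mathbb R^n,\mathbb R^m)}=\mathfrak S(\mathbb R^n)^{\oplus m}.$$
   Context: $\mathbb N=\{1,2,\ldots\}$. For a function $\varphi:\mathbb R\to\mathbb R$ define the real vector spaces of functions $\mathbb R^n\to\mathbb R$ $$\mathcal N_\varphi^1(\mathbb R^n):=\operatorname{span}\{x\mapsto\varphi(a\cdot x+b)\mid a\in\mathbb R^n,\ b\in\mathbb R\},$$ recursively for $l\ge2$, $$\mathcal N_\varphi^l(\mathbb R^n):=\operatorname{span}\{x\mapsto\varphi(f(x)+b)\mid f\in\mathcal N_\varphi^{l-1}(\mathbb R^n),\ b\in\mathbb R\},$$ and $\mathcal N_\varphi^\infty(\mathbb R^n):=\bigcup_{l\ge1}\mathcal N_\varphi^l(\mathbb R^n)$. For $m$ outputs, $\mathcal N_\varphi^l(\mathbb R^n,\mathbb R^m):=\mathcal N_\varphi^l(\mathbb R^n)^{\oplus m}$ (functions $\mathbb R^n\to\mathbb R^m$ all of whose components lie in $\mathcal N_\varphi^l(\mathbb R^n)$) and $\mathcal N_\varphi^\infty(\mathbb R^n,\mathbb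 R^m):=\bigcup_{l\ge1}\mathcal N_\varphi^l(\mathbb R^n,\mathbb R^m)$. Overline denotes uniform closure (closure with respect to the supremum norm over $\mathbb R^n$), and $\overline{\operatorname{span}}\,S:=\overline{\operatorname{span}S}$ with $\mathbb R$-linear span. For $a\in\mathbb R^n$, $p_a:\mathbb R^n\to\mathbb R$ is $p_a(x):=a\cdot x$. Define $$\mathfrak S(\mathbb R):=\{f\in C(\mathbb R)\mid\lim_{x\to-\infty}f(x)\text{ and }\lim_{x\to\infty}f(x)\text{ exist in }\mathbb R\},$$ with $C(\mathbb R)$ the continuous functions $\mathbb R\to\mathbb R$, and more generally $$\mathfrak S(\mathbb R^n):=\overline{\operatorname{span}}\Big\{\prod_{j=1}^m(g_j\circ p_{a_j})\ \Big|\ m\in\mathbb N,\ g_j\in\mathfrak S(\mathbb R),\ a_j\in\mathbb R^n\Big\}.$$ *)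

(* Defs.v *)
From HB Require Import structures.
From mathcomp Require Import all_boot all_order all_algebra.
From mathcomp Require Import all_classical all_reals all_analysis.
Set Implicit Arguments.
Unset Strict Implicit.
Unset Printing Implicit Defensive.
Import Order.TTheory GRing.Theory Num.Theory.
Import numFieldNormedType.Exports.
Local Open Scope classical_set_scope.
Local Open Scope ring_scope.

Definition fspan (R : realType) (T : Type) (S : set (T -> R)) : set (T -> R) :=
  [set f | exists (k : nat) (c : 'I_k -> R) (g : 'I_k -> T -> R),
    (forall i, S (g i)) /\ f = (fun x => \sum_(i < k) c i * g i x)].

Definition uclosure (T : choiceType) (V : uniformType) (A : set (T -> V)) :
    set (T -> V) :=
  @closure {uniform T -> V} A.

Definition dotp (R : realType) (n : nat) (a x : 'rV[R]_n) : R :=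
  \sum_(i < n) a 0 i * x 0 i.

(* [nnet phi n l] is the space of networks with [l] hidden layers; it is only
   meaningful for [l >= 1], and [l = 0] is given the value [set0]. *)
Fixpoint nnet (R : realType) (phi : R -> R) (n l : nat) :
    set ('rV[R]_n -> R) :=
  match l with
  | 0 => set0
  | l'.+1 =>
    match l' with
    | 0 => fspan [set h | exists (a : 'rV[R]_n) (b : R),
                    h = (fun x => phi (dotp a x + b))]
    | _.+1 => fspan [set h | exists (f : 'rV[R]_n -> R) (b : R),
                    @nnet R phi n l' f /\ h = (fun x => phi (f x + b))]
    end
  end.

Arguments nnet {R} phi n l _.

Definition nnet_inf (R : realType) (phi : R -> R) (n : nat) :
    set ('rV[R]_n -> R) :=
  \bigcup_(l in [set l | (1 <= l)%N]) nnet phi n l.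

Arguments nnet_inf {R} phi n _.

(* The [m]-fold direct sum of a space of real functions on R^n, seen as a space
   of functions to R^m. *)
Definition dsum (R : realType) (n m : nat) (A : set ('rV[R]_n -> R)) :
    set ('rV[R]_n -> 'rV[R]_m) :=
  [set f | forall j : 'I_m, A (fun x => f x 0 j)].

Arguments dsum {R n} m A _.

Definition nnet_out (R : realType) (phi : R -> R) (n m l : nat) :
    set ('rV[R]_n -> 'rV[R]_m) :=
  dsum m (nnet phi n l).

Arguments nnet_out {R} phi n m l _.

Definition nnet_out_inf (R : realType) (phi : R -> R) (n m : nat) :
    set ('rV[R]_n -> 'rV[R]_m) :=
  \bigcup_(l in [set l | (1 <= l)%N]) nnet_out phi n m l.

Arguments nnet_out_inf {R} phi n m _.

Definition sigmoidal (R : realType) : set (R -> R) :=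
  [set g | [/\ continuous g, cvg (g x @[x --> -oo]) & cvg (g x @[x --> +oo])]].

Definition sigmoidal_alg (R : realType) (n : nat) : set ('rV[R]_n -> R) :=
  uclosure (fspan [set h | exists (m : nat) (g : 'I_m -> R -> R)
                             (a : 'I_m -> 'rV[R]_n),
    [/\ (1 <= m)%N, forall j, sigmoidal (g j) &
        h = (fun x => \prod_(j < m) g j (dotp (a j) x))]]).

Arguments sigmoidal_alg R n _ : clear implicits.

(* Main.v *)
(* Staircases built from rescaled copies of [phi] approximate every sigmoidal
   function of one variable uniformly, so [g o f] is a limit of combinations of
   the [phi (a * f + b)] for every sigmoidal [g] and every function [f].

   Upper bound: the algebra spanned by the products of ridge functions consists
   of bounded functions, so by Weierstrass its uniform closure is stable under
   composition with [phi], and hence contains the networks of every depth.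

   Lower bound: a sigmoidal function of a linear form, shifted to be at least 1,
   is the exponential of a limit of one-layer networks. Exponentials of such
   limits are limits of two-layer networks, and they span an algebra because
   [exp u * exp v = exp (u + v)]; that algebra contains all the products. *)

Require Import Defs.
From HB Require Import structures.
From mathcomp Require Import all_boot all_order all_algebra.
From mathcomp Require Import all_classical all_reals all_analysis.
From mathcomp Require Import ring lra.
Import Order.TTheory GRing.Theory Num.Theory.
Import numFieldNormedType.Exports.
Local Open Scope classical_set_scope.
Local Open Scope ring_scope.

Set Implicit Arguments.
Unset Strict Implicit.
Unset Printing Implicit Defensive.

(** * Uniform closures and linear spans *)

(** Unfolds the topology of uniform convergence once and for all; later arguments about closures use
    only this epsilon form. *)
Lemma uclosureP (R : realType) (T : choiceType) (V : pseudoMetricType R)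
    (A : set (T -> V)) (f : T -> V) :
  uclosure A f <->
  forall e : R, 0 < e -> exists2 g, A g & forall x, ball (f x) e (g x).
Proof.
split=> [clAf e e0|Af B /uniform_nbhs[E []]].
  have /clAf[g [Ag fg]] : nbhs (f : {uniform T -> V})
      [set g : T -> V | forall x, ball (f x) e (g x)].
    apply/uniform_nbhs; exists [set xy | ball xy.1 e xy.2]; split.
      by rewrite -entourage_ballE; exists e.
    by move=> h /= fh x; exact: fh.
  by exists g.
rewrite -entourage_ballE => -[e /= e0 eE] EB; have [g Ag fg] := Af _ e0.
by exists g; split=> //; apply: EB => y _; apply: eE; exact: fg.
Qed.

Lemma uclosure_realP (R : realType) (T : choiceType)
    (A : set (T -> R)) (f : T -> R) :
  uclosure A f <->
  forall e : R, 0 < e -> exists2 g, A g & forall x, `|f x - g x| < e.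
Proof. exact: uclosureP. Qed.

Lemma sub_uclosure (R : realType) (T : choiceType) (A : set (T -> R)) :
  A `<=` uclosure A.
Proof.
move=> f Af; apply/uclosure_realP => e e0.
by exists f => // x; rewrite subrr normr0.
Qed.

Lemma uclosure_min (R : realType) (T : choiceType) (A B : set (T -> R)) :
  A `<=` uclosure B -> uclosure A `<=` uclosure B.
Proof.
move=> AB f /uclosure_realP Af; apply/uclosure_realP => e e0.
have e20 : 0 < e / 2 by rewrite divr_gt0.
have [g /AB/uclosure_realP/(_ _ e20)[h Bh gh] fg] := Af _ e20.
exists h => // x; rewrite -(subrKA (g x)) (le_lt_trans (ler_normD _ _))//.
by rewrite [ltRHS](splitr e) ltrD.
Qed.

Definition linear_set (R : realType) (T : Type) (V : set (T -> R)) :=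
  V (fun=> 0) /\
  forall (c : R) f g, V f -> V g -> V (fun x => c * f x + g x).

Lemma linear_setZ (R : realType) (T : Type) (V : set (T -> R)) c f :
  linear_set V -> V f -> V (fun x => c * f x).
Proof.
move=> [V0 VD] Vf; have := VD c _ _ Vf V0.
by congr V; apply/funext => x; rewrite addr0.
Qed.

Lemma linear_setD (R : realType) (T : Type) (V : set (T -> R)) f g :
  linear_set V -> V f -> V g -> V (fun x => f x + g x).
Proof.
move=> [V0 VD] Vf /(VD 1 _ _ Vf).
by congr V; apply/funext => x; rewrite mul1r.
Qed.

Lemma linear_setB (R : realType) (T : Type) (V : set (T -> R)) f g :
  linear_set V -> V f -> V g -> V (fun x => f x - g x).
Proof.
move=> [V0 VD] Vf Vg; have := VD (- 1) _ _ Vg Vf.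
by congr V; apply/funext => x; rewrite mulN1r addrC.
Qed.

Lemma linear_set_sum (R : realType) (T : Type) (V : set (T -> R)) k
    (g : 'I_k -> T -> R) :
  linear_set V -> (forall i, V (g i)) -> V (fun x => \sum_(i < k) g i x).
Proof.
move=> Vl; elim: k g => [|k IHk] g Vg.
  by have := Vl.1; congr V; apply/funext => x; rewrite big_ord0.
have := linear_setD Vl (Vg ord0) (IHk _ (fun i => Vg (lift ord0 i))).
by congr V; apply/funext => x; rewrite big_ord_recl.
Qed.

(** Serves as the induction principle for spans: inclusions and bounds are checked on generators
    only. *)
Lemma fspan_min (R : realType) (T : Type) (S V : set (T -> R)) :
  linear_set V -> S `<=` V -> fspan S `<=` V.
Proof.
move=> Vl SV _ [k [c [g [Sg ->]]]].
by apply: linear_set_sum => // i; apply: linear_setZ => //; exact: SV.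
Qed.

Lemma sub_fspan (R : realType) (T : Type) (S : set (T -> R)) : S `<=` fspan S.
Proof.
move=> f Sf; exists 1%N, (fun=> 1), (fun=> f); split=> //.
by apply/funext => x; rewrite big_ord1 mul1r.
Qed.

Lemma fspan_linear (R : realType) (T : Type) (S : set (T -> R)) :
  linear_set (fspan S).
Proof.
split=> [|c _ _ [k [a [f [Sf ->]]]] [l [b [g [Sg ->]]]]].
  exists 0%N, (fun=> 0), (fun _ _ => 0); split; first by case.
  by apply/funext => x; rewrite big_ord0.
exists (k + l)%N,
  (fun i : 'I_(k + l) => match fintype.split i with inl j => c * a j | inr j => b j end),
  (fun i : 'I_(k + l) => match fintype.split i with inl j => f j | inr j => g j end); split.
  by move=> i; case: (fintype.split i).
apply/funext => x; rewrite big_split_ord mulr_sumr; congr (_ + _).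
  apply: eq_bigr => i _; case: split_ordP => j; last first.
    by move/eqP; rewrite eq_lrshift.
  by move/lshift_inj => ->; rewrite mulrA.
apply: eq_bigr => i _; case: split_ordP => j.
  by move/eqP; rewrite eq_rlshift.
by move/rshift_inj => ->.
Qed.

(** The product is bilinear: for one fixed factor, the admissible other factors form a linear set,
    so each factor in turn reduces to generators. *)
Lemma fspan_mul (R : realType) (T : Type) (S : set (T -> R)) :
  (forall f g, S f -> S g -> S (fun x => f x * g x)) ->
  forall f g, fspan S f -> fspan S g -> fspan S (fun x => f x * g x).
Proof.
move=> SM f g Sf Sg; have [S0 SD] := fspan_linear S.
have step h : S h -> fspan S (fun x => h x * g x).
  move=> Sh; move: Sg; apply: (fspan_min (V := [set u | fspan S (fun x => h x * u x)])).
    split=> [|c u v /= Vu /(SD c _ _ Vu)].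
      by rewrite /=; move: S0; congr fspan; apply/funext => x; rewrite mulr0.
    by congr fspan; apply/funext => x; rewrite mulrDr mulrCA.
  by move=> u Su; apply: sub_fspan; exact: SM.
move: Sf; apply: (fspan_min (V := [set u | fspan S (fun x => u x * g x)])) => //.
split=> [|c u v /= Vu /(SD c _ _ Vu)].
  by rewrite /=; move: S0; congr fspan; apply/funext => x; rewrite mul0r.
by congr fspan; apply/funext => x; rewrite mulrDl mulrA.
Qed.

Lemma uclosure_linear (R : realType) (T : choiceType) (V : set (T -> R)) :
  linear_set V -> linear_set (uclosure V).
Proof.
move=> [V0 VD]; split; first exact: sub_uclosure.
move=> c f g /uclosure_realP clf /uclosure_realP clg.
apply/uclosure_realP => e e0.
(* Adding 1 keeps the divisor positive when [c = 0]. *)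
have c0 : 0 < `|c| + 1 by rewrite ltr_wpDl.
have d0 : 0 < e / (`|c| + 1) by rewrite divr_gt0.
have [e20 d20] : 0 < e / 2 /\ 0 < e / 2 / (`|c| + 1) by rewrite !divr_gt0.
have [[f' Vf' ff'] [g' Vg' gg']] := (clf _ d20, clg _ e20).
exists (fun x => c * f' x + g' x); first exact: VD.
move=> x; rewrite opprD addrACA -mulrBr (le_lt_trans (ler_normD _ _))//.
rewrite [ltRHS](splitr e) ler_ltD// normrM.
have := ltW (ff' x); rewrite ler_pdivlMr// mulrC; apply: le_trans.
by rewrite ler_wpM2r// lerDl.
Qed.

(** * Bernstein polynomials and the Weierstrass theorem *)

(* [bernstein t n h] is the mean of [h] under the binomial law of parameters
   [n] and [t], obtained by conditioning on the first trial. *)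
Fixpoint bernstein (R : realType) (t : R) (n : nat) (h : nat -> R) : R :=
  if n is m.+1 then
    t * bernstein t m (fun k => h k.+1) + (1 - t) * bernstein t m h
  else h 0%N.

Lemma bernstein_linear (R : realType) (t : R) n c h1 h2 :
  bernstein t n (fun k => c * h1 k + h2 k) =
  c * bernstein t n h1 + bernstein t n h2.
Proof.
elim: n h1 h2 => [//|n IHn] h1 h2 /=.
by rewrite (IHn (fun k => h1 k.+1) (fun k => h2 k.+1)) IHn; ring.
Qed.

Lemma bernstein_cst (R : realType) (t : R) n c : bernstein t n (fun=> c) = c.
Proof. by elim: n => [//|n /= ->]; ring. Qed.

Lemma ler_norm_bernstein (R : realType) (t : R) n h1 h2 : 0 <= t <= 1 ->
  (forall k, `|h1 k| <= h2 k) -> `|bernstein t n h1| <= bernstein t n h2.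
Proof.
move=> /andP[t0 t1]; elim: n h1 h2 => [|n IHn] h1 h2 h12 /=; first exact: h12.
rewrite (le_trans (ler_normD _ _))// !normrM (ger0_norm t0).
by rewrite (@ger0_norm _ (1 - t)) ?subr_ge0// lerD// ler_wpM2l ?subr_ge0// IHn.
Qed.

(** Variance plus squared bias. The centre [c] is left free because a success in the first trial
    replaces it by [c - 1] in the induction. *)
Lemma bernstein_variance (R : realType) (t : R) n (c : R) :
  bernstein t n (fun k => (k%:R - c) ^+ 2) =
  n%:R * t * (1 - t) + (n%:R * t - c) ^+ 2.
Proof.
elim: n c => [|n IHn] c /=; first by ring.
have -> : (fun k => (k.+1%:R - c) ^+ 2) = (fun k => (k%:R - (c - 1)) ^+ 2).
  by apply/funext => k; rewrite -natr1; congr (_ ^+ 2); ring.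
rewrite !IHn -natr1; ring.
Qed.

(** The recursion multiplies only by [f] and [1 - f], so it never leaves an algebra containing [f]
    and 1. *)
Lemma bernstein_comp (R : realType) (T : Type) (A : set (T -> R)) f n h :
  linear_set A -> A (fun=> 1) ->
  (forall u v, A u -> A v -> A (fun x => u x * v x)) ->
  A f -> A (fun x => bernstein (f x) n h).
Proof.
move=> Al A1 AM Af; elim: n h => [|n IHn] h /=.
  have := linear_setZ (h 0%N) Al A1.
  by congr A; apply/funext => x; rewrite mulr1.
apply: linear_setD => //; apply: AM => //.
exact: linear_setB.
Qed.

Lemma natr_large (R : realType) (x : R) : exists2 n, (0 < n)%N & x <= n%:R.
Proof.
exists (Num.truncn `|x|).+1 => //.
by rewrite (le_trans (ler_norm x))// ltW// truncnS_gt.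
Qed.

(** Chebyshev's argument: nodes near [t] are handled by uniform continuity, distant ones by the
    variance. The hypotheses on [g] are global because [ler_norm_bernstein] compares values at all
    naturals [k], including those with [k / n > 1]. *)
Lemma bernstein_approx (R : realType) (g : R -> R) (e : R) :
  (forall e : R, 0 < e -> exists2 d : R, 0 < d &
    forall x y, `|x - y| < d -> `|g x - g y| < e) ->
  (exists M : R, forall x, `|g x| <= M) -> 0 < e ->
  exists n, forall t, 0 <= t <= 1 ->
    `|g t - bernstein t n (fun k => g (k%:R / n%:R))| < e.
Proof.
move=> gc [M gM] e0; have [d d0 gd] := gc _ (divr_gt0 e0 (ltr0n _ 4)).
have M0 : 0 <= M by apply: le_trans (gM 0).
(* For a node at distance at least [d], the crude bound [2 * M] is at most [C] times the squared
   distance; [n] is then chosen so that [C / n <= e / 4]. *)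
pose C : R := 2 * M / d ^+ 2.
have C0 : 0 <= C by rewrite divr_ge0 ?sqr_ge0 ?mulr_ge0.
have [n n0 Cn] := natr_large (C * 4 / e).
exists n => t t01.
have nR0 : (0 : R) < n%:R by rewrite ltr0n.
pose q k : R := (k%:R - n%:R * t) ^+ 2.
have bnd (k : nat) : `|g t - g (k%:R / n%:R)| <= e / 4 + C / n%:R ^+ 2 * q k.
  have q0 : 0 <= C / n%:R ^+ 2 * q k.
    by rewrite /q mulr_ge0 ?sqr_ge0// divr_ge0 ?sqr_ge0.
  have [td|td] := ltP `|t - k%:R / n%:R| d.
    by rewrite (le_trans (ltW (gd _ _ td)))// lerDl.
  apply: (@le_trans _ _ (2 * M)).
    by rewrite (le_trans (ler_normB _ _))// [2 * M]mulrDl mul1r lerD.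
  apply: (@le_trans _ _ (C / n%:R ^+ 2 * q k)); last first.
    by rewrite lerDr divr_ge0// ltW.
  have -> : C / n%:R ^+ 2 * q k = 2 * M * ((t - k%:R / n%:R) ^+ 2 / d ^+ 2).
    by rewrite /C /q; field; rewrite !gt_eqF.
  rewrite ler_peMr ?mulr_ge0// ler_pdivlMr ?exprn_gt0// mul1r.
  by rewrite -[leRHS]real_normK ?num_real// lerXn2r ?nnegrE// ltW.
have Bl c h : bernstein t n (fun k => c + - 1 * h k) = c - bernstein t n h.
  have -> : (fun k => c + - 1 * h k) = (fun k => - 1 * h k + c).
    by apply/funext => k; rewrite addrC.
  by rewrite bernstein_linear bernstein_cst; ring.
have V : bernstein t n (fun k => C / n%:R ^+ 2 * q k + e / 4) < e.
  rewrite bernstein_linear bernstein_cst /q bernstein_variance subrr expr0n/= addr0.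
  have -> : C / n%:R ^+ 2 * (n%:R * t * (1 - t)) = C / n%:R * (t * (1 - t)).
    by field; rewrite gt_eqF.
  have : C / n%:R <= e / 4.
    rewrite ler_pdivrMr// mulrC -ler_pdivrMr ?divr_gt0// invf_div.
    by rewrite mulrA.
  have : 0 <= C / n%:R by rewrite divr_ge0// ltW.
  case/andP: t01; nra.
rewrite -Bl; apply: le_lt_trans V; apply: ler_norm_bernstein => // k.
by rewrite mulN1r [leRHS]addrC.
Qed.

(** * Tails, uniform continuity and boundedness of sigmoidal functions *)

Lemma cvgNy_dist (R : realType) (f : R -> R) (e : R) :
  cvg (f x @[x --> -oo]) -> 0 < e ->
  exists M, forall x, x <= M -> `|lim (f x @[x --> -oo]) - f x| < e.
Proof.
move=> /cvgrPdist_lt/(_ e) + e0 => /(_ e0)[M [_ fM]].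
by exists (M - 1) => x xM; apply: fM; rewrite (le_lt_trans xM)// ltrBlDr ltrDl.
Qed.

Lemma cvgy_dist (R : realType) (f : R -> R) (e : R) :
  cvg (f x @[x --> +oo]) -> 0 < e ->
  exists M, forall x, M <= x -> `|lim (f x @[x --> +oo]) - f x| < e.
Proof.
move=> /cvgrPdist_lt/(_ e) + e0 => /(_ e0)[M [_ fM]].
by exists (M + 1) => x xM; apply: fM; rewrite (lt_le_trans _ xM)// ltrDl.
Qed.

Lemma sigmoidal_tails (R : realType) (g : R -> R) (e : R) :
  sigmoidal g -> 0 < e -> exists2 M : R, 0 < M &
    (forall x y : R, x <= - M -> y <= - M -> `|g x - g y| < e) /\
    (forall x y : R, M <= x -> M <= y -> `|g x - g y| < e).
Proof.
move=> [_ /cvgNy_dist gNy /cvgy_dist gy] e0.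
have e20 : 0 < e / 2 by rewrite divr_gt0.
have [[M1 gM1] [M2 gM2]] := (gNy _ e20, gy _ e20).
pose M := 1 + (`|M1| + `|M2|).
have [MM1 MM2] : - M <= M1 /\ M2 <= M.
  have := ler_norm M2; have := ler_norm (- M1); rewrite normrN.
  by have := normr_ge0 M1; have := normr_ge0 M2; rewrite /M; split; lra.
exists M; first by rewrite ltr_pwDl// addr_ge0.
split=> x y xM yM.
  rewrite -(subrKA (lim (g x @[x --> -oo]))) (le_lt_trans (ler_normD _ _))//.
  rewrite [ltRHS]splitr ltrD// ?[`|g x - _|]distrC gM1//.
    exact: le_trans xM MM1.
  exact: le_trans yM MM1.
rewrite -(subrKA (lim (g x @[x --> +oo]))) (le_lt_trans (ler_normD _ _))//.
rewrite [ltRHS]splitr ltrD// ?[`|g x - _|]distrC gM2//.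
  exact: le_trans xM.
exact: le_trans yM.
Qed.

(** Heine's theorem, by a near-covering of the segment with the radius tending to [0^'+]. Only [x]
    is confined to the segment, which eases gluing with the tails. *)
Lemma continuous_segment_unif (R : realType) (g : R -> R) (a b e : R) :
  continuous g -> 0 < e -> exists2 d : R, 0 < d &
    forall x y, a <= x <= b -> `|x - y| < d -> `|g x - g y| < e.
Proof.
move=> gc e0; have /compact_near_coveringP := @segment_compact R a b.
move=> /(_ _ (0^'+) (fun d x => forall y, `|x - y| < d -> `|g x - g y| < e) _).
case=> [x _|/= d d0 gd]; last first.
  exists (d / 2); first by rewrite divr_gt0.
  move=> x y xab; apply: (gd (d / 2)); rewrite /= ?divr_gt0 ?in_itv//.
  by rewrite sub0r normrN gtr0_norm ?divr_gt0// gtr_pMr// invf_lt1// ltr1n.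
have e20 : 0 < e / 2 by rewrite divr_gt0.
have /cvgrPdist_lt/(_ _ e20)[r /= r0 gr] := gc x.
have r20 : 0 < r / 2 by rewrite divr_gt0.
(* Halving the radius leaves room for both moves, from [x] to [x'] and from [x'] to [y]. *)
exists (ball x (r / 2), [set d | d < r / 2]).
  split=> /=; first exact: nbhsx_ballx.
  exact: nbhs_right_lt.
move=> [x' d] /= [xx' dr] y x'y.
rewrite -(subrKA (g x)) (le_lt_trans (ler_normD _ _))//.
rewrite [ltRHS]splitr ltrD// ?[`|g x' - _|]distrC; apply: gr; rewrite /=.
  by rewrite (lt_trans xx')// gtr_pMr// invf_lt1// ltr1n.
rewrite -(subrKA x') (le_lt_trans (ler_normD _ _))// [ltRHS]splitr ltrD//.
exact: lt_trans x'y dr.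
Qed.

Lemma sigmoidal_unif (R : realType) (g : R -> R) (e : R) :
  sigmoidal g -> 0 < e -> exists2 d : R, 0 < d &
    forall x y, `|x - y| < d -> `|g x - g y| < e.
Proof.
move=> Sg e0; have [M M0 [gN gP]] := sigmoidal_tails Sg e0.
have [gc _ _] := Sg.
(* The margin of 1, with a modulus at most 1, ensures that when [x] lies outside the enlarged
   segment, both points lie in the same tail. *)
have [d d0 gd] := continuous_segment_unif (- M - 1) (M + 1) gc e0.
exists (Num.min d 1); first by rewrite lt_min d0 ltr01.
move=> x y; rewrite lt_min => /andP[xyd]; rewrite ltr_norml => /andP[xy1 xy2].
have [xN|xN] := ltP x (- M - 1); first by apply: gN; lra.
have [xP|xP] := ltP (M + 1) x; first by apply: gP; lra.
by apply: gd => //; rewrite xN.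
Qed.

Lemma sigmoidal_bounded (R : realType) (g : R -> R) :
  sigmoidal g -> exists M : R, forall x, `|g x| <= M.
Proof.
move=> Sg; have [M M0 [gN gP]] := sigmoidal_tails Sg ltr01.
have [gc _ _] := Sg; have : compact (g @` `[- M, M]).
  apply: continuous_compact; last exact: segment_compact.
  exact: continuous_subspaceT gc.
move=> /compact_bounded[B [_ /(_ (B + 1))]]; rewrite ltrDl => /(_ ltr01) gB.
have {}gB x : - M <= x <= M -> `|g x| <= B + 1.
  by move=> xM; apply: gB; exists x => //=; rewrite in_itv.
have h x y : `|g x - g y| < 1 -> `|g y| <= B + 1 -> `|g x| <= B + 1 + 1.
  move=> xy yB; rewrite -(subrK (g y) (g x)) (le_trans (ler_normD _ _))//.
  by rewrite addrC lerD// ltW.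
exists (B + 1 + 1) => x.
have [xN|xN] := leP x (- M).
  by apply: (h x (- M)); [exact: gN|apply: gB; lra].
have [xP|xP] := leP M x.
  by apply: (h x M); [exact: gP|apply: gB; lra].
by rewrite (le_trans (gB _ _)) ?lerDl//; lra.
Qed.

(** * Staircase approximation of sigmoidal functions *)

(* A staircase with steps at the nodes [t i <= x] takes at [x] the value of [g]
   at the first node after [x], or at the last node if there is none. *)
Lemma staircase_value (R : realType) (g : R -> R) (t : nat -> R) N (x : R) :
  {homo t : i j / (i <= j)%N >-> i <= j} ->
  exists j, [/\ (j <= N)%N,
    g (t 0%N) + \sum_(i < N) (g (t i.+1) - g (t i)) * (t i <= x)%R%:R = g (t j),
    (j < N)%N -> x < t j & (0 < j)%N -> t j.-1 <= x].
Proof.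
move=> tmono; elim: N => [|N [j [jN Sj xj jx]]].
  by exists 0%N; split=> //; rewrite big_ord0 addr0.
have [tNx|xtN] := leP (t N) x.
  exists N.+1; split=> //; rewrite ?ltnn// big_ord_recr/= tNx mulr1 addrA Sj.
  have -> : j = N; last by rewrite addrC subrK.
  apply/eqP; rewrite eqn_leq jN leqNgt/=; apply/negP => /xj.
  by apply/negP; rewrite -leNgt (le_trans _ tNx)// tmono.
exists j; rewrite big_ord_recr/= leNgt xtN mulr0 addr0; split=> //.
  exact: leqW.
move=> _; have [/xj//|Nj] := ltnP j N.
by rewrite (lt_le_trans xtN)// tmono.
Qed.

(** Steep copies of [s] replace the unit steps of a staircase for [g]. At each point at most one
    node is so close that its replacement is poor, and each jump of the staircase is small. *)
Lemma sigmoidal_approx (R : realType) (s g : R -> R) (K e : R) :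
  (forall x, `|s x| <= K) ->
  (forall e : R, 0 < e -> exists2 L : R, 0 < L &
    (forall x, x <= - L -> `|s x| < e) /\
    (forall x, L <= x -> `|s x - 1| < e)) ->
  sigmoidal g -> 0 < e ->
  exists (c0 a : R) N (c b : nat -> R),
    forall x, `|g x - (c0 + \sum_(i < N) c i * s (a * x + b i))| < e.
Proof.
move=> sK s01 Sg e0; have K0 : 0 <= K by apply: le_trans (sK 0).
have K3 : 0 < K + 3 by rewrite ltr_wpDl.
(* The error budget in units of [e1]: 1 for the staircase itself, [K + 1] for the one close node, 1
   for all the others together. *)
pose e1 := e / (K + 3); have e10 : 0 < e1 by rewrite divr_gt0.
have [M M0 [gN gP]] := sigmoidal_tails Sg e10.
have [d d0 gd] := sigmoidal_unif Sg e10.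
have [N N0 dN] := natr_large (2 * M / d + 1).
have NR0 : (0 : R) < N%:R by rewrite ltr0n.
pose h := 2 * M / N%:R; have h0 : 0 < h by rewrite divr_gt0 ?mulr_gt0.
have hd : h < d.
  rewrite ltr_pdivrMr// [ltRHS]mulrC -ltr_pdivrMr//; apply: lt_le_trans dN.
  by rewrite ltrDl.
pose t (i : nat) := - M + i%:R * h.
have tS i : t i.+1 = t i + h by rewrite /t -natr1; ring.
have t0 : t 0%N = - M by rewrite /t mul0r addr0.
have tN : t N = M by rewrite /t /h; field; rewrite gt_eqF.
have tmono : {homo t : i j / (i <= j)%N >-> i <= j}.
  by move=> i j ij; rewrite lerD2l ler_pM2r// ler_nat.
have Ni0 : (0 : R) < N%:R^-1 by rewrite invr_gt0.
have [L L0 [sN sP]] := s01 _ Ni0.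
pose c i : R := g (t i.+1) - g (t i).
(* With this slope, distance [h / 2] from a node becomes distance [L] in the argument of [s], where
   [s] is within [1 / N] of its step. *)
pose l := 2 * L / h; have l0 : 0 < l by rewrite divr_gt0 ?mulr_gt0.
exists (g (t 0%N)), l, N, c, (fun i => - (l * t i)) => x.
have ce i : `|c i| <= e1.
  by apply/ltW/gd; rewrite tS addrAC subrr add0r gtr0_norm.
pose r i : R := `|s (l * x - l * t i) - (t i <= x)%R%:R|.
have rK i : r i <= K + 1.
  rewrite (le_trans (ler_normB _ _))// lerD//.
  by case: (t i <= x); rewrite ?normr1 ?normr0.
have far i : h / 2 <= `|x - t i| -> r i <= N%:R^-1.
  have lL : L = l * (h / 2) by rewrite /l; field; rewrite gt_eqF.
  rewrite /r -mulrBr; have [tx|xt] := leP (t i) x.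
    rewrite ger0_norm ?subr_ge0// => hx; apply/ltW/sP.
    by rewrite lL ler_pM2l.
  rewrite ltr0_norm ?subr_lt0// subr0 => hx; apply/ltW/sN.
  by rewrite lL -mulrN ler_pM2l// lerNr.
have rsum : \sum_(i < N) r i <= K + 2.
  have cst n : (n <= N)%N -> n%:R * N%:R^-1 <= (1 : R).
    by move=> nN; rewrite ler_pdivrMr// mul1r ler_nat.
  (* The nodes have spacing [h], so all nodes other than [i0] are at distance at least [h / 2]. *)
  have [i0 near_i0|all_far] := pickP (fun i : 'I_N => `|x - t i| < h / 2).
    rewrite (bigD1 i0)//= (_ : K + 2 = K + 1 + 1); last by ring.
    apply: lerD => //.
    apply: (@le_trans _ _ (\sum_(i < N | i != i0) N%:R^-1)).
      apply: ler_sum => i ii0; apply: far; move: near_i0.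
      rewrite ltr_norml => /andP[x1 x2].
      have : t i.+1 <= t i0 \/ t i0.+1 <= t i.
        move: ii0; rewrite neq_ltn => /orP[ii0|ii0]; [left|right]; exact: tmono.
      rewrite !tS => -[ti|ti].
        by rewrite (le_trans _ (ler_norm _))//; lra.
      by rewrite distrC (le_trans _ (ler_norm _))//; lra.
    by rewrite sumr_const -[_ *+ #|_|]mulr_natl cst// -[leqRHS]card_ord max_card.
  apply: (@le_trans _ _ (\sum_(i < N) N%:R^-1)).
    by apply: ler_sum => i _; apply: far; rewrite leNgt all_far.
  rewrite sumr_const -[_ *+ #|_|]mulr_natl card_ord (le_trans (cst _ (leqnn N)))//; lra.
have [j [jN Sj xj jx]] := staircase_value g N x tmono.
(* Left of [- M] the staircase sits at its first node and right of [M] at its last, so the tails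
   apply; in between, [x] and [t j] are at most [h < d] apart. *)
have gj : `|g x - g (t j)| < e1.
  have [x0|xM] := ltP x (- M).
    have -> : j = 0%N.
      case: (posnP j) => // j0; move: (le_lt_trans (jx j0) x0).
      by rewrite ltNge -t0 tmono.
    by apply: gN; rewrite ?t0// ltW.
  have [xN|xN] := leP M x.
    have -> : j = N.
      apply/eqP; rewrite eqn_leq jN leqNgt/=; apply/negP => /xj.
      by apply/negP; rewrite -leNgt (le_trans _ xN)// -tN tmono.
    by apply: gP; rewrite ?tN.
  have j0 : (0 < j)%N.
    by case: posnP => // j0; move: xj; rewrite j0 t0 N0 => /(_ isT); lra.
  have := jx j0; have : t j = t j.-1 + h by rewrite -tS prednK.
  move=> tj jx'; apply: gd; have xtj : x < t j.
    have [/xj//|Nj] := ltnP j N.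
    by rewrite (lt_le_trans xN)// -tN tmono.
  by rewrite ltr0_norm ?subr_lt0//; lra.
rewrite -(subrKA (g (t j))) (le_lt_trans (ler_normD _ _))//.
have -> : e = e1 + e1 * (K + 2) by rewrite /e1; field; rewrite gt_eqF.
apply: ltr_leD => //; rewrite -Sj opprD addrACA subrr add0r -sumrB.
rewrite (le_trans (ler_norm_sum _ _ _))//.
apply: (@le_trans _ _ (\sum_(i < N) e1 * r i)).
  apply: ler_sum => i _; rewrite -mulrBr normrM [`|_ - s _|]distrC.
  by rewrite ler_wpM2r//; exact: ce.
by rewrite -mulr_sumr ler_wpM2l// ltW.
Qed.

Lemma sigmoidal_affine (R : realType) (phi : R -> R) (a b : R) :
  sigmoidal phi -> sigmoidal (fun x => a * phi x + b).
Proof.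
move=> [pc pN pP]; split.
- by move=> x; apply: cvgD; [apply: cvgM; [exact: cvg_cst|exact: pc]|exact: cvg_cst].
- by apply: is_cvgD; [apply: is_cvgM => //; exact: is_cvg_cst|exact: is_cvg_cst].
- by apply: is_cvgD; [apply: is_cvgM => //; exact: is_cvg_cst|exact: is_cvg_cst].
Qed.

(** The staircase estimate holds at every real argument, hence at [u x] uniformly in [x], with no
    condition on [u]. The unequal limits allow [phi] to be normalised to a function [s] with limits
    0 and 1. *)
Lemma uclosure_sigmoidal (R : realType) (T : choiceType) (V : set (T -> R))
    (phi g : R -> R) (u : T -> R) :
  sigmoidal phi ->
  lim (phi x @[x --> -oo]) <> lim (phi x @[x --> +oo]) ->
  linear_set V -> (forall a b, V (fun x => phi (a * u x + b))) ->
  sigmoidal g -> uclosure V (fun x => g (u x)).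
Proof.
move=> Sphi; have [_ pN pP] := Sphi.
set lN := lim _; set lP := lim _ => lNP Vl Vphi Sg.
(* Slope 0 yields the constants [phi b], and some [phi b] is nonzero since otherwise both limits
   would agree. *)
have V1 : V (fun=> 1).
  have [b pb0] : exists b, phi b != 0.
    apply: contrapT => /forallNP p0; apply: lNP; rewrite /lN /lP.
    have -> : phi = fun=> 0 by apply/funext => x; apply/eqP/negPn/negP/p0.
    by rewrite !lim_cst.
  have := linear_setZ (phi b)^-1 Vl (Vphi 0 b).
  by congr V; apply/funext => x; rewrite mul0r add0r mulVf.
pose D := lP - lN; have D0 : D != 0.
  by rewrite subr_eq0; apply/eqP => /esym.
pose s x := D^-1 * phi x + - (D^-1 * lN).
have [K sK] := sigmoidal_bounded (sigmoidal_affine D^-1 (- (D^-1 * lN)) Sphi).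
have Vs a b : V (fun x => s (a * u x + b)).
  have := Vl.2 D^-1 _ _ (Vphi a b) (linear_setZ (- (D^-1 * lN)) Vl V1).
  by congr V; apply/funext => x; rewrite /s mulr1.
have s01 (e : R) : 0 < e -> exists2 L : R, 0 < L &
    (forall x, x <= - L -> `|s x| < e) /\
    (forall x, L <= x -> `|s x - 1| < e).
  move=> e0; have eD0 : 0 < e * `|D| by rewrite mulr_gt0 ?normr_gt0.
  have [M1 pM1] := cvgNy_dist pN eD0; have [M2 pM2] := cvgy_dist pP eD0.
  have [L L0 [LM1 LM2]] : exists2 L : R, 0 < L & - L <= M1 /\ M2 <= L.
    exists (1 + (`|M1| + `|M2|)); first by rewrite ltr_pwDl// addr_ge0.
    have := ler_norm M2; have := ler_norm (- M1); rewrite normrN.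
    by have := normr_ge0 M1; have := normr_ge0 M2; split; lra.
  exists L => //; split=> x Lx.
    have -> : s x = (phi x - lN) / D by rewrite /s; ring.
    rewrite normrM normfV ltr_pdivrMr ?normr_gt0// distrC.
    by apply: pM1; exact: le_trans Lx LM1.
  have -> : s x - 1 = (phi x - lP) / D.
    by rewrite /s /D; field; rewrite -/D.
  rewrite normrM normfV ltr_pdivrMr ?normr_gt0// distrC.
  by apply: pM2; exact: le_trans Lx.
apply/uclosure_realP => e e0.
have [c0 [a [N [c [b gcab]]]]] := sigmoidal_approx sK s01 Sg e0.
exists (fun x => c0 * 1 + \sum_(i < N) c i * s (a * u x + b i)).
  apply: linear_setD => //; first exact: linear_setZ.
  by apply: linear_set_sum => // i; apply: linear_setZ.
by move=> x; rewrite mulr1.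
Qed.

(** * Operations producing sigmoidal functions *)

Lemma sigmoidal_comp (R : realType) (f g : R -> R) :
  continuous f -> sigmoidal g -> sigmoidal (fun x => f (g x)).
Proof.
move=> fc [gc gN gP]; split.
- by move=> x; apply: continuous_comp; [exact: gc|exact: fc].
- apply/cvg_ex; exists (f (lim (g x @[x --> -oo]))).
  exact: (cvg_comp _ _ gN (fc _)).
- apply/cvg_ex; exists (f (lim (g x @[x --> +oo]))).
  exact: (cvg_comp _ _ gP (fc _)).
Qed.

Lemma sigmoidal_shift (R : realType) (g : R -> R) (b : R) :
  sigmoidal g -> sigmoidal (fun x => g (x + b)).
Proof.
move=> [gc gN gP]; split.
- move=> x; apply: (@continuous_comp _ _ _ (fun x => x + b) g); last exact: gc.
  by apply: cvgD; [exact: cvg_id|exact: cvg_cst].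
- apply/cvg_ex; exists (lim (g x @[x --> -oo])).
  apply/cvgrPdist_lt => e /(cvgNy_dist gN)[M gM].
  exists (M - b); split; first exact: num_real.
  by move=> x xM; apply: gM; rewrite -lerBrDr ltW.
- apply/cvg_ex; exists (lim (g x @[x --> +oo])).
  apply/cvgrPdist_lt => e /(cvgy_dist gP)[M gM].
  exists (M - b); split; first exact: num_real.
  by move=> x xM; apply: gM; rewrite -lerBlDr ltW.
Qed.

Lemma continuous_maxr (R : realType) (c : R) : continuous (Num.max c).
Proof.
move=> x; apply/cvgrPdist_lt => e e0; near=> y.
have : `|x - y| < e by near: y; exact: cvgr_dist_lt.
apply: le_lt_trans; rewrite /Num.max /=.
have [cx|cx] := ltP c x; have [cy|cy] := ltP c y; rewrite ?subrr ?normr0//.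
  by rewrite ler_norml; have := ler_norm (x - y); have := normr_ge0 (x - y); lra.
by rewrite ler_norml distrC; have := ler_norm (y - x); have := normr_ge0 (y - x); lra.
Unshelve. all: by end_near. Qed.

(** Truncation to [[- C, C]], with the minimum written through [Num.max] so that [continuous_maxr]
    suffices. It makes [expR] sigmoidal without changing it on the range of a bounded function. *)
Lemma sigmoidal_clamp (R : realType) (C : R) :
  sigmoidal (fun x => Num.max (- C) (- Num.max (- C) (- x))).
Proof.
have Nc : continuous (-%R : R -> R) by move=> x; exact: opp_continuous.
split.
- move=> x; apply: (@continuous_comp _ _ _ (fun x => - Num.max (- C) (- x))).
    apply: (@continuous_comp _ _ _ (fun x => Num.max (- C) (- x)) -%R).
      apply: (@continuous_comp _ _ _ -%R); first exact: Nc.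
      exact: continuous_maxr.
    exact: Nc.
  exact: continuous_maxr.
- apply/cvg_ex; exists (- C); apply/cvgrPdist_lt => e e0.
  exists (- `|C|); split; first exact: num_real.
  move=> x xC /=; suff -> : Num.max (- C) (- Num.max (- C) (- x)) = - C.
    by rewrite subrr normr0.
  have : - C < - x by have := ler_norm (- C); rewrite normrN; lra.
  move=> Cx; rewrite (max_r (ltW Cx)) opprK max_l//.
  by have := ler_norm C; lra.
(* The limit is not written [C] because [C] may be negative. *)
- apply/cvg_ex; exists (Num.max (- C) C); apply/cvgrPdist_lt => e e0.
  exists `|C|; split; first exact: num_real.
  move=> x xC /=; suff -> : Num.max (- C) (- x) = - C.
    by rewrite opprK subrr normr0.
  by rewrite max_l//; have := ler_norm C; lra.
Qed.

Lemma clampK (R : realType) (C x : R) : `|x| <= C ->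
  Num.max (- C) (- Num.max (- C) (- x)) = x.
Proof.
rewrite ler_norml => /andP[Cx xC].
rewrite (@max_r _ _ _ (- x)) ?lerN2// opprK; exact: max_r.
Qed.

(** * Bounded functions and composition in uniform closures *)

Lemma bounded_linear_set (R : realType) (T : Type) :
  linear_set [set f : T -> R | exists M : R, forall x, `|f x| <= M].
Proof.
split=> [|c f g [M fM] [N gN]]; first by exists 0 => x; rewrite normr0.
exists (`|c| * M + N) => x.
by rewrite (le_trans (ler_normD _ _))// lerD// normrM ler_wpM2l.
Qed.

Lemma uclosure_bounded (R : realType) (T : choiceType) (A : set (T -> R)) :
  (forall f, A f -> exists M : R, forall x, `|f x| <= M) ->
  forall f, uclosure A f -> exists M : R, forall x, `|f x| <= M.
Proof.
move=> Ab f /uclosure_realP/(_ _ ltr01)[g /Ab[M gM] fg].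
exists (1 + M) => x; rewrite -(subrK (g x) (f x)).
by rewrite (le_trans (ler_normD _ _))// lerD// ltW.
Qed.

(** Uniform continuity of [g] carries an approximation of [u] by [v] to one of their compositions
    with [g], so only elements of [A] itself need treatment. *)
Lemma uclosure_sigmoidal_comp (R : realType) (T : choiceType)
    (A B : set (T -> R)) (g : R -> R) (u : T -> R) : sigmoidal g ->
  (forall v, A v -> uclosure B (fun x => g (v x))) ->
  uclosure A u -> uclosure B (fun x => g (u x)).
Proof.
move=> Sg AB /uclosure_realP Au; apply/uclosure_realP => e e0.
have e20 : 0 < e / 2 by rewrite divr_gt0.
have [d d0 gd] := sigmoidal_unif Sg e20.
have [v /AB/uclosure_realP/(_ _ e20)[w Bw vw] uv] := Au _ d0.
exists w => // x; rewrite -(subrKA (g (v x))) (le_lt_trans (ler_normD _ _))//.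
by rewrite [ltRHS](splitr e) ltrD// gd.
Qed.

Lemma uclosure_weierstrass (R : realType) (T : choiceType) (A : set (T -> R))
    (phi : R -> R) (f : T -> R) :
  linear_set A -> A (fun=> 1) ->
  (forall u v, A u -> A v -> A (fun x => u x * v x)) ->
  (exists M : R, forall x, `|f x| <= M) ->
  sigmoidal phi -> A f -> uclosure A (fun x => phi (f x)).
Proof.
move=> Al A1 AM [M0 fM0] Sphi Af; apply/uclosure_realP => e e0.
have [M Mpos fM] : exists2 M : R, 0 < M & forall x, `|f x| <= M.
  exists (`|M0| + 1); first by rewrite ltr_wpDl.
  by move=> x; rewrite (le_trans (fM0 x))// (le_trans (ler_norm M0))// lerDl.
pose g t := phi (2 * M * t - M).
have gb : exists K : R, forall x, `|g x| <= K.
  by have [K phiK] := sigmoidal_bounded Sphi; exists K => x; exact: phiK.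
have gu (e' : R) : 0 < e' -> exists2 d : R, 0 < d &
    forall x y, `|x - y| < d -> `|g x - g y| < e'.
  move=> e'0; have [d d0 phid] := sigmoidal_unif Sphi e'0.
  exists (d / (2 * M)); first by rewrite divr_gt0 ?mulr_gt0.
  move=> x y; rewrite ltr_pdivlMr ?mulr_gt0// => xy; apply: phid.
  rewrite (_ : _ - _ = (x - y) * (2 * M)); last by ring.
  by rewrite normrM (@gtr0_norm _ (2 * M)) ?mulr_gt0.
have [n gn] := bernstein_approx gu gb e0.
(* The affine map from [[- M, M]] onto [[0, 1]] applied to [f], inverse to the rescaling in [g]; the
   factor 1 exhibits the constant as a multiple of an element of [A]. *)
pose v x := (2 * M)^-1 * f x + 2^-1 * 1.
have Av : A v by apply: Al.2 => //; exact: linear_setZ.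
exists (fun x => bernstein (v x) n (fun k => g (k%:R / n%:R))).
  exact: bernstein_comp.
move=> x; have -> : phi (f x) = g (v x).
  by rewrite /g /v; congr phi; field; rewrite gt_eqF.
apply: gn; have := fM x; rewrite ler_norml => /andP[Mf fxM].
have -> : v x = (f x + M) / (2 * M) by rewrite /v; field; rewrite gt_eqF.
rewrite divr_ge0 ?mulr_ge0 ?(ltW Mpos)//=; last by lra.
by rewrite ler_pdivrMr ?mulr_gt0//; lra.
Qed.

(** * Upper bound: networks lie in the closed algebra *)

Lemma dotpZ (R : realType) n (c : R) (a x : 'rV[R]_n) :
  dotp (c *: a) x = c * dotp a x.
Proof. by rewrite /dotp mulr_sumr; apply: eq_bigr => i _; rewrite mxE mulrA. Qed.

Lemma nnet_linear (R : realType) (phi : R -> R) n l :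
  linear_set (nnet phi n l.+1).
Proof. by case: l => [|l]; exact: fspan_linear. Qed.

Lemma nnet_bounded (R : realType) (phi : R -> R) n l f : sigmoidal phi ->
  nnet phi n l.+1 f -> exists M : R, forall x, `|f x| <= M.
Proof.
move=> /sigmoidal_bounded[M phiM].
case: l => [|l]; apply: (fspan_min (bounded_linear_set R _)) => h [f' [b]].
  by move=> ->; exists M.
by move=> [_ ->]; exists M.
Qed.

(** Names the generators written inline in [sigmoidal_alg], which is convertible to
    [uclosure (fspan (@sigmoidal_gen R n))]. *)
Definition sigmoidal_gen (R : realType) n : set ('rV[R]_n -> R) :=
  [set h | exists (m : nat) (g : 'I_m -> R -> R) (a : 'I_m -> 'rV[R]_n),
    [/\ (1 <= m)%N, forall j, sigmoidal (g j) &
        h = (fun x => \prod_(j < m) g j (dotp (a j) x))]].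

Lemma sigmoidal_gen1 (R : realType) n (g : R -> R) (a : 'rV[R]_n) :
  sigmoidal g -> sigmoidal_gen (fun x => g (dotp a x)).
Proof.
move=> Sg; exists 1%N, (fun=> g), (fun=> a); split=> //.
by apply/funext => x; rewrite big_ord1.
Qed.

Lemma sigmoidal_cst (R : realType) (c : R) : sigmoidal (fun=> c).
Proof.
by split=> [x| |]; [exact: cvg_cst|exact: is_cvg_cst|exact: is_cvg_cst].
Qed.

Lemma sigmoidal_gen_mul (R : realType) n (f g : 'rV[R]_n -> R) :
  sigmoidal_gen f -> sigmoidal_gen g -> sigmoidal_gen (fun x => f x * g x).
Proof.
move=> [k [u [a [k0 Su ->]]]] [l [v [b [l0 Sv ->]]]].
exists (k + l)%N,
  (fun i : 'I_(k + l) => match fintype.split i with inl j => u j | inr j => v j end),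
  (fun i : 'I_(k + l) => match fintype.split i with inl j => a j | inr j => b j end).
split; [by rewrite addn_gt0 k0| |].
  by move=> i; case: (fintype.split i).
apply/funext => x; rewrite big_split_ord; congr (_ * _).
  apply: eq_bigr => i _; case: split_ordP => j; last first.
    by move/eqP; rewrite eq_lrshift.
  by move/lshift_inj => ->.
apply: eq_bigr => i _; case: split_ordP => j.
  by move/eqP; rewrite eq_rlshift.
by move/rshift_inj => ->.
Qed.

Lemma sigmoidal_gen_bounded (R : realType) n (f : 'rV[R]_n -> R) :
  fspan (@sigmoidal_gen R n) f -> exists M : R, forall x, `|f x| <= M.
Proof.
apply: (fspan_min (bounded_linear_set R _)) => _ [m [g [a [_ Sg ->]]]].
elim: m g a Sg => [|m IHm] g a Sg.
  by exists 1 => x; rewrite big_ord0 normr1.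
have [M gM] := sigmoidal_bounded (Sg ord0).
have [N gN] := IHm (fun i => g (lift ord0 i)) (fun i => a (lift ord0 i))
  (fun i => Sg _).
by exists (M * N) => x; rewrite big_ord_recl normrM ler_pM.
Qed.

Lemma nnet_sub_sigmoidal_alg (R : realType) (phi : R -> R) n l :
  sigmoidal phi -> nnet phi n l.+1 `<=` sigmoidal_alg R n.
Proof.
move=> Sphi; have genl := fspan_linear (@sigmoidal_gen R n).
have gen1 : fspan (@sigmoidal_gen R n) (fun=> 1).
  by apply/sub_fspan/(sigmoidal_gen1 0 (sigmoidal_cst 1)).
have algl : linear_set (sigmoidal_alg R n) by exact: uclosure_linear.
elim: l => [|l IHl]; apply: fspan_min => // h [f [b]].
  move=> ->; apply/sub_uclosure/sub_fspan.
  exact: (sigmoidal_gen1 f (sigmoidal_shift b Sphi)).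
have Sphib := sigmoidal_shift b Sphi.
(* The inner network is only a limit of elements of the algebra, so it is first replaced by a
   genuine element [v], to which Weierstrass applies. *)
move=> [/IHl Sf ->]; apply: (uclosure_sigmoidal_comp Sphib _ Sf) => v Av.
apply: (uclosure_weierstrass genl gen1 _ _ Sphib Av).
  by apply: fspan_mul; exact: sigmoidal_gen_mul.
exact: sigmoidal_gen_bounded Av.
Qed.

(** * Lower bound: exponentials of one-layer limits *)

Lemma sigmoidal_alg_sub_nnet (R : realType) (phi : R -> R) n :
  sigmoidal phi ->
  lim (phi x @[x --> -oo]) <> lim (phi x @[x --> +oo]) ->
  sigmoidal_alg R n `<=` uclosure (nnet phi n 2).
Proof.
move=> Sphi philim.
have [N1l N2l] := (nnet_linear phi n 0, nnet_linear phi n 1).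
have N1g g a : sigmoidal g -> uclosure (nnet phi n 1) (fun x => g (dotp a x)).
  apply: (uclosure_sigmoidal Sphi) => // c b.
  apply: sub_fspan; exists (c *: a), b.
  by apply/funext => x; rewrite dotpZ.
have N2g g f : sigmoidal g -> nnet phi n 1 f ->
    uclosure (nnet phi n 2) (fun x => g (f x)).
  move=> Sg N1f; apply: (uclosure_sigmoidal Sphi) => // c b.
  apply: sub_fspan; exists (fun x => c * f x), b; split=> //.
  exact: linear_setZ.
(* The exponents range over the closure, since the logarithms [w] used below are only limits of
   one-layer networks. *)
pose X := [set h : 'rV[R]_n -> R | exists u,
  uclosure (nnet phi n 1) u /\ h = (fun x => expR (u x))].
have N1cl := uclosure_linear N1l.
have XN2 : fspan X `<=` uclosure (nnet phi n 2).
  apply: fspan_min; first exact: (uclosure_linear N2l).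
  move=> _ [u [N1u ->]].
  have [C uC] := uclosure_bounded (fun f => nnet_bounded Sphi) N1u.
  (* [expR] is not sigmoidal, but its composition with the clamp at a bound [C] of [u] is, and both
     agree on the values of [u]. *)
  have SC := sigmoidal_comp (@continuous_expR R) (sigmoidal_clamp C).
  have := uclosure_sigmoidal_comp SC (fun v => N2g _ v SC) N1u.
  by congr uclosure; apply/funext => x; rewrite clampK.
have Xl := fspan_linear X.
have X1 : fspan X (fun=> 1).
  apply: sub_fspan; exists (fun=> 0); split; first exact: N1cl.1.
  by apply/funext => x; rewrite expR0.
have XM : forall f g, fspan X f -> fspan X g -> fspan X (fun x => f x * g x).
  apply: fspan_mul => _ _ [u [N1u ->]] [v [N1v ->]].
  exists (fun x => u x + v x); split; first exact: (linear_setD N1cl).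
  by apply/funext => x; rewrite expRD.
have Xg g a : sigmoidal g -> fspan X (fun x => g (dotp a x)).
  move=> Sg; have [K gK] := sigmoidal_bounded Sg.
  (* As [g >= - K], the shifted function is at least 1, so the maximum changes nothing and
     [g = expR w - (K + 1)]; the maximum makes the outer map continuous on the whole line. *)
  pose w x := ln (Num.max 1 (1 * g x + (K + 1))).
  have Sw : sigmoidal w.
    apply: (sigmoidal_comp (f := fun y => ln (Num.max 1 y))); last exact: sigmoidal_affine.
    move=> y; apply: (continuous_comp (@continuous_maxr R 1 y)).
    by apply: continuous_ln; rewrite lt_max ltr01.
  have Xw : fspan X (fun x => expR (w (dotp a x))).
    by apply: sub_fspan; exists (fun x => w (dotp a x)); split=> //; exact: N1g.
  have := linear_setB Xl Xw (linear_setZ (K + 1) Xl X1).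
  congr fspan; apply/funext => x; rewrite /w.
  have gK1 : 1 <= 1 * g (dotp a x) + (K + 1).
    by have := gK (dotp a x); rewrite ler_norml => /andP[]; lra.
  by rewrite max_r// lnK ?posrE ?(lt_le_trans ltr01)//; ring.
apply: uclosure_min; apply: fspan_min; first exact: (uclosure_linear N2l).
move=> _ [m [g [a [_ Sg ->]]]]; apply: XN2.
elim: m g a Sg => [|m IHm] g a Sg.
  by move: X1; congr fspan; apply/funext => x; rewrite big_ord0.
have := XM _ _ (Xg _ (a ord0) (Sg ord0))
  (IHm _ (fun i => a (lift ord0 i)) (fun i => Sg (lift ord0 i))).
by congr fspan; apply/funext => x; rewrite big_ord_recl.
Qed.

(** * Several outputs and the final equalities *)

Lemma uclosure_rowP (R : realType) (T : choiceType) m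
    (A : set (T -> 'rV[R]_m)) (f : T -> 'rV[R]_m) :
  uclosure A f <-> forall e : R, 0 < e ->
    exists2 g, A g & forall x j, `|f x 0 j - g x 0 j| < e.
Proof.
split=> [/(uclosureP (V := 'rV[R]_m)) Af e /Af[g Ag fg]|Af].
  by exists g => // x j; exact: (fg x).2.
apply: (uclosureP (V := 'rV[R]_m) A f).2 => e e0; have [g Ag fg] := Af _ e0.
by exists g => // x; split=> // i j; rewrite ord1; exact: fg.
Qed.

Unset Implicit Arguments.

Theorem theorem5p9 (R : realType) (n : nat) (phi : R -> R) :
  (1 <= n)%N ->
  continuous phi ->
  cvg (phi x @[x --> -oo]) ->
  cvg (phi x @[x --> +oo]) ->
  lim (phi x @[x --> -oo]) <> lim (phi x @[x --> +oo]) ->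
  (uclosure (nnet_inf phi n) = uclosure (nnet phi n 2) /\
   uclosure (nnet phi n 2) = sigmoidal_alg R n) /\
  (forall m : nat, (1 <= m)%N ->
     uclosure (nnet_out_inf phi n m) = dsum m (sigmoidal_alg R n)).
Proof.
move=> _ pc pN pP philim; have Sphi : sigmoidal phi by split.
have inf_alg : nnet_inf phi n `<=` sigmoidal_alg R n.
  by move=> f [[//|l] _]; exact: nnet_sub_sigmoidal_alg.
have two_inf : nnet phi n 2 `<=` nnet_inf phi n by move=> f; exists 2%N.
have alg_two := sigmoidal_alg_sub_nnet (n := n) Sphi philim.
have two_alg : uclosure (nnet phi n 2) = sigmoidal_alg R n.
  apply/seteqP; split=> //; apply: uclosure_min.
  by move=> f /two_inf; exact: inf_alg.
split; first split=> //.
  apply/seteqP; split; first by rewrite two_alg; exact: uclosure_min.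
  by apply: uclosure_min => f /two_inf; exact: sub_uclosure.
move=> m _; apply/seteqP; split=> f.
  move=> /uclosure_rowP Of j; rewrite -two_alg; apply/uclosure_realP => e e0.
  have e20 : 0 < e / 2 by rewrite divr_gt0.
  have [g [l l1 Ng] fg] := Of _ e20.
  have /alg_two/uclosure_realP/(_ _ e20)[h Nh gh] : sigmoidal_alg R n (fun x => g x 0 j).
    by apply: inf_alg; exists l => //; exact: Ng.
  exists h => // x; rewrite -(subrKA (g x 0 j)) (le_lt_trans (ler_normD _ _))//.
  by rewrite [ltRHS](splitr e) ltrD.
move=> Sf; apply/uclosure_rowP => e e0.
(* All outputs are approximated at the same depth 2, as [nnet_out_inf] requires one depth common to
   the components. *)
have /choice[g Ng] : forall j, exists g, nnet phi n 2 g /\ forall x, `|f x 0 j - g x| < e.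
  move=> j; have /alg_two/uclosure_realP/(_ _ e0)[g Ng fg] := Sf j.
  by exists g.
exists (fun x => \row_j g j x).
  exists 2%N => // j; have [+ _] := Ng j; congr nnet.
  by apply/funext => x; rewrite mxE.
by move=> x j; rewrite mxE; apply: (Ng j).2.
Qed.
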